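(* Let $(\Omega,\mu)$ be an atomless finite measure space and let $p(\cdot),q(\cdot)$ be exponents on $\Omega$ with $q(\cdot)\le p(\cdot)$. If the inclusion $L^{p(\cdot)}(\mu)\hookrightarrow L^{q(\cdot)}(\mu)$ is disjointly strictly singular, then $$\lim_{x\to\mu(\Omega)^-}(\mu(\Omega)-x)^{\left(\frac{p-q}{p\,q}\right)^*(x)}=0.$$
   Context: An exponent on $\Omega$ is a real measurable function $p$ with $1\le p(t)<\infty$ (possibly unbounded). The variable Lebesgue space $L^{p(\cdot)}(\mu)$ is the space of all (classes of) real measurable $f$ on $\Omega$ such that $\rho_{p(\cdot)}(f/r)<\infty$ for some $r>0$, where $\rho_{p(\cdot)}(f)=\int_\Omega |f(t)|^{p(t)}d\mu$, with the Luxemburg norm $\|f\|_{p(\cdot)}=\inf\{r>0:\rho_{p(\cdot)}(f/r)\le 1\}$. On a finite measure space, $q(\cdot)\le p(\cdot)$ a.e. implies that $L^{p(\cdot)}(\mu)\subset L^{q(\cdot)}(\mu)$ with continuous inclusion. For measurable $f$ on $\Omega$, the distribution function is $\mu_f(s)=\mu(\{t\in\Omega:|f(t)|>s\})$ and the decreasing rearrangement is $f^*(x)=\inf\{s\in[0,\infty):\mu_f(s)\le x\}$ for $x\in[0,\mu(\Omega))$. An operator $T:E\to F$ from a Banach lattice $E$ to a Banach space $F$ is disjointly strictly singular (DSS) if there is no normalized pairwise disjoint sequence $(f_n)$ in $E$ such that the restriction of $T$ to the closed linear span $[f_n]$ is an isomorphism onto its image. *)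

(* Defs.v *)
From HB Require Import structures.
From mathcomp Require Import all_boot all_order all_algebra.
From mathcomp Require Import all_classical all_reals all_analysis.

Set Implicit Arguments.
Unset Strict Implicit.
Unset Printing Implicit Defensive.

Import Order.TTheory GRing.Theory Num.Theory.
Import numFieldNormedType.Exports.

Local Open Scope classical_set_scope.
Local Open Scope ring_scope.

(* The Banach lattice [E] and the Banach space [F] are given by a module, a
   norm taking the value +oo off the space and, for [E], its underlying set and
   its disjointness relation. The norms may be seminorms: the elements of a
   space of classes of functions are then represented by functions. *)
Section disjointly_strictly_singular.
Context {R : realType} {V W : lmodType R}.
Variables (E : set V) (normE : V -> \bar R) (disjE : V -> V -> Prop).
Variables (normF : W -> \bar R) (L : V -> W).

Definition linear_span (f : nat -> V) : set V :=
  [set g | exists (n : nat) (a : nat -> R), g = \sum_(i < n) a i *: f i].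

Definition closed_linear_span (f : nat -> V) : set V :=
  [set g | E g /\ forall eps : R, 0 < eps ->
    exists2 h, linear_span f h & (normE (g - h) < eps%:E)%E].

(* For linear [L]: the restriction of [L] to the subspace [X] is bounded, and
   it is injective with bounded inverse [L @` X -> X]. *)
Definition isomorphism_onto_image (X : set V) : Prop :=
  (exists2 C : R, 0 < C &
     forall g, X g -> (normF (L g) <= C%:E * normE g)%E) /\
  (exists2 c : R, 0 < c &
     forall g, X g -> (c%:E * normE g <= normF (L g))%E).

Definition disjointly_strictly_singular : Prop :=
  ~ exists f : nat -> V,
      [/\ forall n, E (f n) /\ normE (f n) = 1%E,
          forall n m, n <> m -> disjE (f n) (f m) &
          isomorphism_onto_image (closed_linear_span f)].

End disjointly_strictly_singular.

Section variable_lebesgue.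
Context {d : measure_display} {T : measurableType d} {R : realType}.
Variable mu : {measure set T -> \bar R}.
Implicit Types (p q f g : T -> R).

Definition atomless : Prop :=
  forall A, measurable A -> (0 < mu A)%E ->
    exists B, [/\ measurable B, B `<=` A & (0 < mu B < mu A)%E].

Definition exponent p : Prop :=
  measurable_fun [set: T] p /\ forall t, 1 <= p t.

Definition modular p f : \bar R := (\int[mu]_t (`|f t| `^ p t)%:E)%E.

Definition variable_Lebesgue p : set (T -> R) :=
  [set f : T -> R | measurable_fun [set: T] f /\
    exists2 r : R, 0 < r & (modular p (fun t => f t / r)%R < +oo)%E].

Definition luxemburg_norm p f : \bar R :=
  ereal_inf [set r%:E | r in
    [set r : R | 0 < r /\ (modular p (fun t => f t / r)%R <= 1)%E]].

Definition ae_disjoint f g : Prop :=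
  {ae mu, forall t, Num.min `|f t| `|g t| = 0}.

(* Meaningful when L^p(.) is included in L^q(.), for instance when q <= p
   almost everywhere and [mu] is finite. *)
Definition inclusion_DSS p q : Prop :=
  disjointly_strictly_singular (variable_Lebesgue p) (luxemburg_norm p)
    ae_disjoint (luxemburg_norm q) (@id (T -> R)).

Definition distribution_function f (s : R) : \bar R :=
  mu [set t | s < `|f t|].

(* +oo at [x] when no [s] is admissible, which may happen at [x = 0] if [f] is
   unbounded. *)
Definition decreasing_rearrangement f (x : R) : \bar R :=
  ereal_inf [set s%:E | s in
    [set s : R | 0 <= s /\ (distribution_function f s <= x%:E)%E]].

End variable_lebesgue.

(* Main.v *)
Require Import Defs.
From HB Require Import structures.
From mathcomp Require Import all_boot all_order all_algebra.
From mathcomp Require Import all_classical all_reals all_analysis.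
From mathcomp Require Import measurable_realfun ring lra.

Set Implicit Arguments.
Unset Strict Implicit.
Unset Printing Implicit Defensive.

Import Order.TTheory GRing.Theory Num.Theory.
Import numFieldNormedType.Exports.

Local Open Scope classical_set_scope.
Local Open Scope ring_scope.

(** Write phi = 1/q - 1/p = (p - q)/(pq) and M = mu(Omega). The proof is by
    contraposition: if (M - x)^(phi^*(x)) does not tend to 0 as x -> M, a
    disjoint sequence has equivalent norms of L^p(.) and L^q(.) on its closed
    span.

    Failure of the limit gives delta > 0 and arbitrarily small e = M - x with
    e^(phi^*(x)) >= delta. By definition of the rearrangement the set where
    |phi| is at most about phi^*(x) has measure at least M - x = e, so the level
    set {e^|phi| >= delta/2} has measure at least e ([rearrangement_level]).
    Along a sequence e_k decreasing at least geometrically, each such level set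
    contains a set of measure exactly e_k, because mu is atomless
    ([atomless_subset]); removing from it all the later ones costs at most half
    of its measure and leaves disjoint sets B_k ([disjoint_subsets]). Their
    measures b_k lie in [e_k/2, e_k], and since |phi| <= 1 this gives
    b_k^phi >= delta/4 on B_k.

    Put f_k = b_k^(-1/p) 1_(B_k). Then the p-modular of f_k is 1, so f_k is
    normalized in L^p(.). As b_k^(-q/p) = b_k^(-1) (b_k^phi)^q, the q-modular of
    y f_k is at least the mean over B_k of (c y)^q, where c is a lower bound of
    b_k^phi. If a combination h = sum a_k f_k has q-modular at most 1, each
    c |a_k| is therefore at most 1; and for numbers in [0, 1] the power p is
    below the power q, so the p-modular of c h is at most 1 as well. Hence
    c |h|_p <= |h|_q on the span of the f_k, and, both norms being
    subadditive and |.|_q being dominated by |.|_p, on its closure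
    ([disjoint_bumps_not_DSS]). *)

(** * Modulars and Luxemburg norms *)

Section modular_theory.
Context {d : measure_display} {T : measurableType d} {R : realType}.
Variable mu : {measure set T -> \bar R}.
Implicit Types (p q f g : T -> R).

Lemma measurable_fun_powR_fun f p :
  measurable_fun [set: T] f -> measurable_fun [set: T] p ->
  measurable_fun [set: T] (fun t => f t `^ p t).
Proof.
move=> mf mp; rewrite /powR.
apply: measurable_fun_ifT.
- by apply: measurable_fun_eqr => //; exact: measurable_cst.
- have -> : (fun t => (p t == 0)%:R : R) = (fun t => if p t == 0 then 1 else 0).
    by apply/funext => t; case: (p t == 0).
  apply: measurable_fun_ifT; [|exact: measurable_cst..].
  by apply: measurable_fun_eqr => //; exact: measurable_cst.
- apply: measurableT_comp; first exact: measurable_expR.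
  by apply: measurable_funM => //; exact: measurableT_comp.
Qed.

Lemma measurable_modular_integrand p f :
  measurable_fun [set: T] p -> measurable_fun [set: T] f ->
  measurable_fun [set: T] (fun t => (`|f t| `^ p t)%:E).
Proof.
move=> mp mf; apply/measurable_EFinP; apply: measurable_fun_powR_fun => //.
exact: measurableT_comp.
Qed.

Lemma measurable_divc f (r : R) : measurable_fun [set: T] f ->
  measurable_fun [set: T] (fun t => f t / r).
Proof. by move=> mf; apply: measurable_funM => //; exact: measurable_cst. Qed.

Lemma exponent_gt0 p t : exponent p -> 0 < p t.
Proof. by case=> _ p1; exact: lt_le_trans (p1 t). Qed.

Lemma modular_ae_le p q f g : exponent p -> exponent q ->
  measurable_fun [set: T] f -> measurable_fun [set: T] g ->
  {ae mu, forall t, `|f t| `^ p t <= `|g t| `^ q t} ->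
  (modular mu p f <= modular mu q g)%E.
Proof.
move=> p_exp q_exp mf mg fg; have [mp _] := p_exp; have [mq _] := q_exp.
apply: ae_ge0_le_integral => //.
- exact: measurable_modular_integrand.
- exact: measurable_modular_integrand.
- by apply: filterS fg => t + _; rewrite lee_fin.
Qed.

Lemma modular_le p f g : exponent p ->
  measurable_fun [set: T] f -> measurable_fun [set: T] g ->
  (forall t, `|f t| <= `|g t|) -> (modular mu p f <= modular mu p g)%E.
Proof.
move=> p_exp mf mg fg; apply: modular_ae_le => //; apply: aeW => t.
by rewrite ge0_ler_powR ?nnegrE// ltW// exponent_gt0.
Qed.

(** Exponents are at least 1, so shrinking a function by a factor a <= 1 shrinks
    its modular at least by the same factor. *)
Lemma modular_scale p f (a : R) : exponent p -> measurable_fun [set: T] f ->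
  0 < a <= 1 -> (modular mu p (fun t => a * f t)%R <= a%:E * modular mu p f)%E.
Proof.
move=> p_exp mf /andP[a0 a1]; rewrite /modular -ge0_integralZl//=; first last.
- by rewrite lee_fin ltW.
- by apply: measurable_modular_integrand => //; exact: p_exp.1.
apply: ge0_le_integral => //.
- apply: measurable_modular_integrand; first exact: p_exp.1.
  by apply: measurable_funM => //; exact: measurable_cst.
- apply: emeasurable_funM => //.
  by apply: measurable_modular_integrand => //; exact: p_exp.1.
- move=> t _; rewrite -EFinM lee_fin normrM (gtr0_norm a0).
  by rewrite ge1r_powRZ ?a0//; exact: p_exp.2.
Qed.

(** The triangle inequality for the Luxemburg norm, in the form in which the
    unit balls enter below: (f + g)/(r + s) is a convex combination of f/r and
    g/s, and y |-> y^(p t) is convex. *)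
Lemma modular_convex_add p f g (r s : R) : exponent p ->
  measurable_fun [set: T] f -> measurable_fun [set: T] g -> 0 < r -> 0 < s ->
  (modular mu p (fun t => f t / r)%R <= 1)%E ->
  (modular mu p (fun t => g t / s)%R <= 1)%E ->
  (modular mu p (fun t => (f t + g t) / (r + s))%R <= 1)%E.
Proof.
move=> p_exp mf mg r0 s0 fr gs.
have rs0 : 0 < r + s by rewrite addr_gt0.
pose w : R := r / (r + s).
have w0 : 0 <= w by rewrite divr_ge0// ltW.
have w1 : w <= 1 by rewrite ler_pdivrMr// mul1r lerDl ltW.
have w1' : 0 <= 1 - w by rewrite subr_ge0.
have mF := measurable_modular_integrand p_exp.1 (measurable_divc r mf).
have mG := measurable_modular_integrand p_exp.1 (measurable_divc s mg).
apply: (@le_trans _ _ (w%:E * modular mu p (fun t => f t / r)%R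
    + (1 - w)%:E * modular mu p (fun t => g t / s)%R)%E); last first.
  apply: (@le_trans _ _ (w%:E * 1 + (1 - w)%:E * 1)%E).
    by apply: leeD; apply: lee_wpmul2l => //; rewrite lee_fin.
  by rewrite !mule1 -EFinD addrCA subrr addr0.
rewrite /modular -!ge0_integralZl//=; try by move=> t _; rewrite lee_fin powR_ge0.
rewrite -ge0_integralD//; first last.
- exact: emeasurable_funM.
- by move=> t _; rewrite -EFinM lee_fin mulr_ge0// powR_ge0.
- exact: emeasurable_funM.
- by move=> t _; rewrite -EFinM lee_fin mulr_ge0// powR_ge0.
apply: ge0_le_integral => //.
- apply: measurable_modular_integrand; first exact: p_exp.1.
  by apply: measurable_divc; exact: measurable_funD.
- by apply: emeasurable_funD; exact: emeasurable_funM.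
move=> t _; rewrite -!EFinM -EFinD lee_fin.
have -> : (f t + g t) / (r + s) = w * (f t / r) + (1 - w) * (g t / s).
  by rewrite /w; field; rewrite !gt_eqF.
apply: (@le_trans _ _ ((w * `|f t / r| + (1 - w) * `|g t / s|) `^ p t)).
  apply: ge0_ler_powR.
  - by rewrite ltW// exponent_gt0.
  - by rewrite nnegrE.
  - by rewrite nnegrE addr_ge0// mulr_ge0.
  by rewrite (le_trans (ler_normD _ _))// (normrM w) (normrM (1 - w))
    (ger0_norm w0) (ger0_norm w1').
have w01 : 0 <= w <= 1 by rewrite w0 w1.
by apply: (convex_powR (p_exp.2 t) (Itv01 w0 w1)) => //=;
  rewrite ?inE/= ?in_itv/= ?normr_ge0.
Qed.

Lemma luxemburg_norm_le p f (r : R) : 0 < r ->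
  (modular mu p (fun t => f t / r)%R <= 1)%E -> (luxemburg_norm mu p f <= r%:E)%E.
Proof. by move=> r0 fr; apply: ereal_inf_lbound; exists r. Qed.

(** The admissible radii form an up-set, so any r above their infimum is
    admissible. *)
Lemma luxemburg_norm_lt p f (r : R) : exponent p -> measurable_fun [set: T] f ->
  (luxemburg_norm mu p f < r%:E)%E ->
  0 < r /\ (modular mu p (fun t => f t / r)%R <= 1)%E.
Proof.
move=> p_exp mf /ereal_inf_lt[_ [s [s0 fs] <-]]; rewrite lte_fin => sr.
have r0 := lt_trans s0 sr; split => //; apply: le_trans fs.
apply: modular_le => //; try exact: measurable_divc.
move=> t; rewrite !normrM ler_wpM2l// !gtr0_norm ?invr_gt0//.
by rewrite lef_pV2 ?posrE// ltW.
Qed.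

(** A radius r < 1 cannot be admissible: by [modular_scale] it would give
    modular f <= r < 1. *)
Lemma luxemburg_norm_modular1 p f : exponent p -> measurable_fun [set: T] f ->
  modular mu p f = 1%E -> luxemburg_norm mu p f = 1%E.
Proof.
move=> p_exp mf f1; apply/eqP; rewrite eq_le; apply/andP; split.
  apply: luxemburg_norm_le => //.
  by under [fun t => f t / 1]funext do rewrite divr1; rewrite f1.
apply/ereal_infP => _ [r [r0 fr] <-]; rewrite lee_fin leNgt; apply/negP => r1.
have : (1 <= r%:E * modular mu p (fun t => f t / r)%R)%E.
  rewrite -f1; apply: le_trans (modular_scale (a := r) p_exp _ _).
  - have -> // : (fun t => r * (f t / r)) = f.
    by apply/funext => t; rewrite mulrC divfK// gt_eqF.
  - exact: measurable_divc.
  - by rewrite r0 ltW.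
rewrite leNgt => /negP; apply; apply: le_lt_trans (_ : r%:E < 1)%E.
  by rewrite -[leRHS]mule1 lee_wpmul2l// lee_fin ltW.
by rewrite lte_fin.
Qed.

End modular_theory.

(** * The inclusion of L^p(.) in L^q(.) *)

Section inclusion.
Context {d : measure_display} {T : measurableType d} {R : realType}.
Variable mu : {finite_measure set T -> \bar R}.
Variables p q : T -> R.
Hypotheses (p_exp : exponent p) (q_exp : exponent q).
Hypothesis qp : {ae mu, forall t, q t <= p t}.

Let K : R := fine (mu [set: T]) + 1.
Let K1 : 1 <= K. Proof. by rewrite lerDr fine_ge0. Qed.
Let K0 : 0 < K. Proof. exact: lt_le_trans K1. Qed.

(** Since y^q <= 1 + y^p, the q-modular of f/r is at most K = M + 1, and the
    extra factor K in the radius brings it down to 1. *)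
Lemma modular_inclusion (f : T -> R) (r : R) : measurable_fun [set: T] f ->
  (modular mu p (fun t => f t / r)%R <= 1)%E ->
  (modular mu q (fun t => f t / (K * r))%R <= 1)%E.
Proof.
move=> mf fr.
have mF := measurable_modular_integrand p_exp.1 (measurable_divc r mf).
have qK : (modular mu q (fun t => f t / r)%R <= K%:E)%E.
  apply: (@le_trans _ _ (\int[mu]_t (1 + (`|f t / r| `^ p t)%:E))%E).
    apply: ae_ge0_le_integral => //.
    - by apply: measurable_modular_integrand; [exact: q_exp.1|exact: measurable_divc].
    - by move=> t _; rewrite adde_ge0// lee_fin powR_ge0.
    - exact: emeasurable_funD.
    apply: filterS qp => t qpt _; rewrite -EFinD lee_fin.
    have [f1|f1] := leP 1 `|f t / r|.
      by rewrite (le_trans (ler_powR f1 qpt))// lerDr.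
    rewrite (@le_trans _ _ 1)// ?lerDl ?powR_ge0//.
    have e1 : 1 `^ q t = 1 :> R by rewrite powR1.
    rewrite -[leRHS]e1 ge0_ler_powR ?nnegrE// ltW//.
    exact: exponent_gt0.
  rewrite ge0_integralD//.
  rewrite integral_cst// mul1e /K EFinD fineK ?fin_num_measure//.
  exact: leeD2l.
have -> : (fun t => f t / (K * r)) = (fun t => K^-1 * (f t / r)).
  by apply/funext => t; rewrite invfM mulrCA.
apply: le_trans (modular_scale mu q_exp (measurable_divc r mf) _) _.
  by rewrite invr_gt0 K0 invf_le1.
by rewrite lee_pdivrMl// mule1.
Qed.

Lemma luxemburg_norm_inclusion (f : T -> R) : measurable_fun [set: T] f ->
  (luxemburg_norm mu q f <= K%:E * luxemburg_norm mu p f)%E.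
Proof.
move=> mf; rewrite -lee_pdivrMl//; apply/ereal_infP => _ [r [r0 fr] <-].
rewrite lee_pdivrMl// -EFinM; apply: luxemburg_norm_le; first exact: mulr_gt0.
exact: modular_inclusion.
Qed.

(** * Disjoint bumps spanning isomorphic subspaces *)

Section disjoint_bumps.
Variables (B : nat -> set T) (c : R).
Hypotheses (mB : forall k, measurable (B k)) (tB : trivIset [set: nat] B).
Hypothesis B0 : forall k, (0 < mu (B k))%E.
Hypothesis c0 : 0 < c.
Let b k : R := fine (mu (B k)).
Hypothesis cB : forall k t, B k t -> c <= b k `^ ((p t - q t) / (p t * q t)).

Let bump k : T -> R := fun t => b k `^ (- (p t)^-1) * \1_(B k) t.

Let muB k : mu (B k) = (b k)%:E.
Proof. by rewrite fineK// fin_num_measure. Qed.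

Let b0 k : 0 < b k. Proof. by rewrite -lte_fin -muB. Qed.

Let measurable_bump k : measurable_fun [set: T] (bump k).
Proof.
apply: measurable_funM; last exact: measurable_indic.
apply: measurable_fun_powR_fun; first exact: measurable_cst.
apply: measurableT_comp => //.
have -> : (fun t => (p t)^-1) = (fun t => p t `^ (-1)).
  by apply/funext => t; rewrite powR_inv1// ltW// exponent_gt0.
by apply: measurableT_comp (measurable_powR _) p_exp.1.
Qed.

Let integral_bump_cst k (y : R) : 0 <= y ->
  (\int[mu]_t (y / b k * \1_(B k) t)%:E = y%:E)%E.
Proof.
move=> y0; under eq_integral do rewrite EFinM.
rewrite ge0_integralZl//; first last.
- by rewrite lee_fin divr_ge0// ltW.
- by apply/measurable_EFinP; exact: measurable_indic.
rewrite integral_indic// setIT; transitivity ((y / b k)%:E * (b k)%:E)%E.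
  by congr (_ * _)%E; exact: muB.
by rewrite -EFinM divfK// gt_eqF.
Qed.

Let modular_bump k : modular mu p (bump k) = 1%E.
Proof.
rewrite -(integral_bump_cst k ler01); apply: eq_integral => t _; congr EFin.
rewrite /bump normrM ger0_norm ?powR_ge0// indicE.
case: (t \in B k); rewrite ?normr1 ?normr0 ?mulr1 ?mulr0.
  rewrite -powRrM mulNr mulVf ?gt_eqF ?exponent_gt0//.
  by rewrite powR_inv1 ?ltW// mul1r.
by rewrite powR0// gt_eqF// exponent_gt0.
Qed.

Let bump_disjoint n m t : n <> m -> bump n t = 0 \/ bump m t = 0.
Proof.
move=> nm; rewrite /bump !indicE.
have [tn|tn] := boolP (t \in B n); last by left; rewrite mulr0.
have [tm|tm] := boolP (t \in B m); last by right; rewrite mulr0.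
by exfalso; apply: nm; apply: (tB I I); exists t; split; exact: set_mem.
Qed.

(** This is where the lower bound on b_k^phi enters, through
    -q/p = -1 + phi q. *)
Let bump_q k t y : B k t -> 0 <= y ->
  (c * y) `^ q t / b k <= (y * b k `^ (- (p t)^-1)) `^ q t.
Proof.
move=> Bt y0; have p0 := exponent_gt0 t p_exp; have q0 := exponent_gt0 t q_exp.
rewrite mulrC [leRHS]powRM ?powR_ge0// -powRrM (powRM _ (ltW c0))//.
rewrite mulrA [leRHS]mulrC ler_wpM2r ?powR_ge0//.
have -> : - (p t)^-1 * q t = - 1 + (p t - q t) / (p t * q t) * q t.
  by field; rewrite !gt_eqF.
rewrite powRD ?(gt_eqF (b0 k)) ?implybT// powR_inv1 ?(ltW (b0 k))//.
rewrite ler_wpM2l ?invr_ge0 ?(ltW (b0 k))// powRrM.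
rewrite ge0_ler_powR ?nnegrE ?powR_ge0 ?(ltW q0) ?(ltW c0)//; exact: cB.
Qed.

Let span_measurable h : linear_span bump h -> measurable_fun [set: T] h.
Proof.
move=> [n [a ->]]; elim: n => [|n IH].
  by rewrite big_ord0; exact: measurable_cst.
rewrite big_ord_recr/=; apply: measurable_funD => //.
by apply: measurable_funM => //; exact: measurable_cst.
Qed.

(** Linear combinations of the bumps are handled pointwise: on each B_k only
    one term survives. *)
Let span_form h : linear_span bump h ->
  exists a : nat -> R, (forall k t, B k t -> h t = a k * b k `^ (- (p t)^-1)) /\
    (forall t, (forall k, ~ B k t) -> h t = 0).
Proof.
move=> [n [a ->]].
have E t : (\sum_(i < n) a i *: bump i) t = \sum_(i < n) a i * bump i t.
  by rewrite fct_sumE.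
exists (fun k => if (k < n)%N then a k else 0); split => [k t Bt|t Bt].
  rewrite E; case: ltnP => kn.
    rewrite (bigD1 (Ordinal kn))//= big1 ?addr0 => [|i ik].
      by rewrite /bump indicE mem_set// mulr1.
    have ik' : (i : nat) <> k by move=> ik'; move/eqP: ik; apply; apply/val_inj.
    have [->|] := bump_disjoint t ik'; first by rewrite mulr0.
    rewrite /bump indicE mem_set// mulr1 => /eqP.
    by rewrite gt_eqF// powR_gt0.
  rewrite big1 ?mul0r// => i _; rewrite /bump indicE memNset ?mulr0//.
  move=> Bi; have ik : (i : nat) = k by apply: (tB I I); exists t.
  by move: (ltn_ord i); rewrite ik ltnNge kn.
by rewrite E big1// => i _; rewrite /bump indicE memNset ?mulr0.
Qed.

(** The unit ball of L^q(.) bounds every coefficient, which makes the p-th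
    power smaller than the q-th power pointwise; no summation over k is
    involved. *)
Let span_comparison h (r : R) : linear_span bump h -> 0 < r ->
  (modular mu q (fun t => h t / r)%R <= 1)%E ->
  (modular mu p (fun t => h t / (r / c))%R <= 1)%E.
Proof.
move=> hs r0 hq; have mh := span_measurable hs.
have [a [aB aN]] := span_form hs.
have r1 : 0 < r^-1 by rewrite invr_gt0.
have hE k t : B k t -> `|h t / r| = `|a k| / r * b k `^ (- (p t)^-1).
  move=> Bt; rewrite (aB k t Bt) !normrM (ger0_norm (powR_ge0 _ _)).
  by rewrite (gtr0_norm r1) mulrAC.
(* Otherwise the q-modular over B_k alone would exceed the mean of
   c |a_k| / r > 1, because y <= y^q for y >= 1. *)
have coef k : c * (`|a k| / r) <= 1.
  rewrite leNgt; apply/negP => y1.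
  have y0 : 0 <= `|a k| / r by rewrite divr_ge0// ltW.
  move: hq; rewrite leNgt => /negP; apply.
  apply: (@lt_le_trans _ _ (c * (`|a k| / r))%:E); first by rewrite lte_fin.
  rewrite -(integral_bump_cst k); last by rewrite mulr_ge0// ltW.
  apply: ge0_le_integral => //.
  - by move=> t _; rewrite lee_fin mulr_ge0// divr_ge0 ?mulr_ge0// ltW.
  - apply/measurable_EFinP; apply: measurable_funM => //; exact: measurable_indic.
  - by apply: measurable_modular_integrand; [exact: q_exp.1|exact: measurable_divc].
  move=> t _; rewrite lee_fin indicE.
  have [/set_mem Bt|_] := boolP (t \in B k); last by rewrite mulr0 powR_ge0.
  rewrite mulr1 (hE k)//; apply: le_trans (bump_q Bt y0).
  rewrite ler_wpM2r ?invr_ge0 ?(ltW (b0 k))// le1r_powR ?(ltW y1)//.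
  exact: q_exp.2.
apply: le_trans hq; apply: modular_ae_le => //; try exact: measurable_divc.
apply: filterS qp => t qpt.
have [[k Bt]|Bt] := pselect (exists k, B k t); last first.
  rewrite aN; last by move=> k Bk; apply: Bt; exists k.
  rewrite !mul0r normr0 !powR0// gt_eqF//; exact: exponent_gt0.
have y0 : 0 <= `|a k| / r by rewrite divr_ge0// ltW.
rewrite [in leRHS](hE k)//; apply: le_trans (bump_q Bt y0).
have -> : `|h t / (r / c)| = c * (`|a k| / r) * b k `^ (- (p t)^-1).
  rewrite -mulrA -(hE k)// -[X in _ = X * _](gtr0_norm c0) -normrM.
  by rewrite invf_div mulrCA.
rewrite powRM ?powR_ge0 ?(mulr_ge0 (ltW c0) y0)// -powRrM mulNr mulVf; last first.
  by rewrite gt_eqF// exponent_gt0.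
rewrite powR_inv1 ?(ltW (b0 k))// ler_wpM2r ?invr_ge0 ?(ltW (b0 k))//.
have [->|a0] := eqVneq (a k) 0.
  by rewrite normr0 mul0r mulr0 !powR0// gt_eqF//; exact: exponent_gt0.
rewrite ger_powR// coef andbT mulr_gt0// divr_gt0// normr_gt0//.
Qed.

(** An element g of the closed span is approximated by h in the span with
    |g - h|_p < e1. Then h has q-norm at most r + K e1, hence p-norm at most
    (r + K e1)/c, and g has p-norm at most (r + K e1)/c + e1, which is
    r/c + e for e1 = e/(K/c + 1). *)
Lemma disjoint_bumps_not_DSS : ~ inclusion_DSS mu p q.
Proof.
apply; exists bump; split.
- move=> k; split; last exact: luxemburg_norm_modular1.
  split => //; exists 1 => //.
  under [fun t => bump k t / 1]funext do rewrite divr1.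
  by rewrite modular_bump ltry.
- move=> n m nm; apply: aeW => t.
  have [->|->] := bump_disjoint t nm.
    by rewrite normr0 min_l.
  by rewrite normr0 min_r.
split; first by exists K => // g [[mg _] _]; exact: luxemburg_norm_inclusion.
exists c => // g [[mg _] gs].
apply/ereal_infP => _ [r [r0 gr] <-].
rewrite -lee_pdivlMl// -EFinM; apply/lee_addgt0Pr => e e0.
pose D := c^-1 * K + 1.
have D0 : 0 < D by rewrite addr_gt0// mulr_gt0// invr_gt0.
pose e1 := e / D.
have e10 : 0 < e1 by rewrite divr_gt0.
have [h hs gh] := gs e1 e10.
have mh := span_measurable hs.
have mgh : measurable_fun [set: T] (g - h) by apply: measurable_funB.
have [_ ghp] := luxemburg_norm_lt p_exp mgh gh.
have hgq : (modular mu q (fun t => (h - g) t / (K * e1))%R <= 1)%E.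
  have mhg : measurable_fun [set: T] (h - g) by apply: measurable_funB.
  apply: modular_inclusion => //; apply: le_trans ghp.
  apply: modular_le => //; try exact: measurable_divc.
  move=> t; rewrite !normrM.
  by rewrite -[(h - g) t]/(h t - g t) -[(g - h) t]/(g t - h t) distrC.
have Ke0 : 0 < K * e1 by rewrite mulr_gt0.
have hq : (modular mu q (fun t => h t / (r + K * e1))%R <= 1)%E.
  have mhg : measurable_fun [set: T] (h - g) by apply: measurable_funB.
  have := modular_convex_add q_exp mg mhg r0 Ke0 gr hgq.
  by congr (_ <= _)%E; congr modular; apply/funext => t; rewrite addrC subrK.
have rK0 : 0 < r + K * e1 by rewrite addr_gt0.
have hp := span_comparison hs rK0 hq.
have gp := modular_convex_add p_exp mh mgh (divr_gt0 rK0 c0) e10 hp ghp.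
rewrite -EFinD.
have -> : c^-1 * r + e = (r + K * e1) / c + e1.
  have eE : e = (c^-1 * K + 1) * e1 by rewrite mulrC divfK// gt_eqF.
  by rewrite {1}eE; field; rewrite gt_eqF.
apply: luxemburg_norm_le; first by rewrite addr_gt0// divr_gt0.
have -> : g = fun t => h t + (g - h) t.
  by apply/funext => t; rewrite addrC subrK.
exact: gp.
Qed.

End disjoint_bumps.
End inclusion.

(** * Subsets of prescribed measure in an atomless finite measure space *)

Section atomless_measure.
Context {d : measure_display} {T : measurableType d} {R : realType}.
Variable mu : {finite_measure set T -> \bar R}.
Implicit Types A B C D : set T.

Let m A : R := fine (mu A).

Let muE A : measurable A -> mu A = (m A)%:E.
Proof. by move=> mA; rewrite fineK// fin_num_measure. Qed.

Let m_ge0 A : 0 <= m A. Proof. exact: fine_ge0. Qed.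

Let m_le A B : measurable A -> measurable B -> A `<=` B -> m A <= m B.
Proof. by move=> mA mB AB; rewrite -lee_fin -!muE// le_measure ?inE. Qed.

Let m_add A B : measurable A -> measurable B -> A `<=` B ->
  m B = m A + m (B `\` A).
Proof.
move=> mA mB AB; apply: EFin_inj; rewrite EFinD -!muE//; last exact: measurableD.
by rewrite addeC (measureDI mu mB mA) setIidr.
Qed.

Hypothesis mu_atomless : atomless mu.

Lemma atomless_half A : measurable A -> 0 < m A ->
  exists B, [/\ measurable B, B `<=` A, 0 < m B & m B <= m A / 2].
Proof.
move=> mA; rewrite -lte_fin -muE// => A0.
have [B [mB BA]] := mu_atomless mA A0.
have -> : (0 < mu B < mu A)%E = (0 < m B < m A) by rewrite !muE.
move=> /andP[B0 BltA].
have AE := m_add mB mA BA.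
have [h|h] := leP (m B) (m A / 2); first by exists B.
exists (A `\` B); split; [exact: measurableD|by move=> t []|lra|lra].
Qed.

Lemma atomless_small A (e : R) : measurable A -> 0 < m A -> 0 < e ->
  exists B, [/\ measurable B, B `<=` A, 0 < m B & m B <= e].
Proof.
move=> mA A0 e0.
have small n : exists B, [/\ measurable B, B `<=` A, 0 < m B & m B <= m A / 2 ^+ n].
  elim: n => [|n [B [mB BA B0 Bn]]].
    by exists A; split => //; rewrite expr0 divr1.
  have [C [mC CB C0 Cn]] := atomless_half mB B0.
  exists C; split => //; first exact: subset_trans BA.
  by rewrite (le_trans Cn)// exprSr invfM mulrA ler_wpM2r.
pose n := Num.bound (m A / e).
have [B [mB BA B0 Bn]] := small n; exists B; split => //.
apply: le_trans Bn _; rewrite ler_pdivrMr ?exprn_gt0// mulrC -ler_pdivrMr//.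
exact: ltW (upper_nthrootP _).
Qed.

(** One step of an exhaustion: C is enlarged inside A, without exceeding the
    measure e, by at least half of the largest possible gain. *)
Let greedy_step A (e : R) C : measurable A -> measurable C -> C `<=` A ->
  m C <= e -> exists C', [/\ measurable C', C `<=` C', C' `<=` A, m C' <= e &
    forall D, measurable D -> C `<=` D -> D `<=` A -> m D <= e ->
      m D - m C <= 2 * (m C' - m C)].
Proof.
move=> mA mC CA Ce.
pose S := [set m D | D in [set D | [/\ measurable D, C `<=` D, D `<=` A & m D <= e]]].
have SC : S (m C) by exists C => //; split.
have ubS : ubound S e by move=> _ [D [_ _ _ De] <-].
have hS : has_sup S by split; [exists (m C)|exists e].
have CS : m C <= sup S by apply: ub_le_sup => //; exists e.
have le_sup D : measurable D -> C `<=` D -> D `<=` A -> m D <= e -> m D <= sup S.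
  by move=> *; apply: ub_le_sup; [exists e|exists D].
have [eqS|ltS] := eqVneq (m C) (sup S).
  exists C; split=> [//|//|//|//|D mD CD DA De].
  by have := le_sup D mD CD DA De; rewrite -eqS; lra.
have gap : 0 < (sup S - m C) / 2 by rewrite divr_gt0// subr_gt0 lt_neqAle ltS.
have [_ [C' [mC' CC' C'A C'e] <-] C'S] := sup_adherent gap hS.
exists C'; split => // D mD CD DA De.
by have := le_sup D mD CD DA De; lra.
Qed.

(** Sierpinski's theorem. The union U of the greedy exhaustion has measure at
    most e. If it were smaller, a small set D of positive measure could be added
    to it, hence to every stage, and every stage would gain at least m D / 2,
    which is impossible as the measure stays below e. *)
Lemma atomless_subset A (e : R) : measurable A -> 0 <= e -> (e%:E <= mu A)%E ->
  exists C, [/\ measurable C, C `<=` A & mu C = e%:E].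
Proof.
move=> mA e0; rewrite muE// lee_fin => eA.
pose P C := [/\ measurable C, C `<=` A & m C <= e].
have /choice[f fP] : forall C, exists C', P C -> [/\ P C', C `<=` C' &
    forall D, P D -> C `<=` D -> m D - m C <= 2 * (m C' - m C)].
  move=> C.
  have [[mC CA Ce]|nP] := pselect (P C); last by exists C.
  have [C' [mC' CC' C'A C'e H]] := greedy_step mA mC CA Ce.
  by exists C' => _; split => // D [mD DA De] CD; exact: H.
pose C n := iter n f set0.
have PC n : P (C n).
  elim: n => [|n IH]; last by have [] := fP _ IH.
  by split; [exact: measurable0|exact: sub0set|rewrite /C/= /m measure0].
have Cm n : C n `<=` C n.+1 by have [] := fP _ (PC n).
pose U := \bigcup_n C n.
have mU : measurable U by apply: bigcup_measurable => n _; case: (PC n).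
have CU n : C n `<=` U by move=> t Ct; exists n.
have UA : U `<=` A by move=> t [n _]; case: (PC n) => _ + _; exact.
have Ue : m U <= e.
  rewrite -lee_fin -muE//.
  have ndC : {homo C : n k / (n <= k)%N >-> (n <= k)%O}.
    by apply/nondecreasing_seqP => n; apply/subsetPset; exact: Cm.
  have cU : (mu \o C) x @[x --> \oo] --> mu U.
    by apply: nondecreasing_cvg_mu => // n; case: (PC n).
  rewrite -(cvg_lim _ cU)//; apply: lime_le; first by apply/cvg_ex; exists (mu U).
  by apply: nearW => n /=; have [mC _ Ce] := PC n; rewrite muE// lee_fin.
exists U; split => //; rewrite muE//; congr EFin; apply/eqP; rewrite eq_le Ue /=.
rewrite leNgt; apply/negP => Ult.
have mAU : measurable (A `\` U) by exact: measurableD.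
have [||D [mD DAU D0 De]] := @atomless_small (A `\` U) (e - m U) mAU _ _.
- by have := m_add mU mA UA; lra.
- by rewrite subr_gt0.
have gain n : m D <= 2 * (m (C n.+1) - m (C n)).
  have [mC CA Ce] := PC n; have [_ _ /(_ (C n `|` D))] := fP _ (PC n).
  have CDm : m (C n `|` D) = m (C n) + m D.
    rewrite (m_add mC (measurableU _ _ mC mD) (@subsetUl _ _ _)).
    congr (_ + m _); apply/seteqP; split => [t [[]//]|t Dt].
    by split; [right|move=> /CU; case: (DAU _ Dt)].
  rewrite CDm addrC addKr; apply; last by move=> t; left.
  split; [exact: measurableU|by move=> t [/CA//|/DAU[]]|].
  by rewrite CDm; have := m_le mC mU (@CU n); lra.
have lin n : n%:R * m D <= 2 * m (C n).
  elim: n => [|n IH]; first by rewrite mul0r mulr_ge0.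
  by have := gain n; rewrite -natr1 mulrDl mul1r; lra.
pose n := Num.bound (2 * e / m D).
have : 2 * e / m D < n%:R by apply: archi_boundP; rewrite divr_ge0 ?mulr_ge0.
rewrite ltr_pdivrMr// => h.
by have [_ _ Ce] := PC n; have := lin n; lra.
Qed.

(** Choose C_k in A_k of measure e_k and remove from it all later C_j: by the
    geometric decay of e, they have total measure at most e_k / 2. Removing the
    earlier sets instead could exhaust C_k, as they are larger. *)
Lemma disjoint_subsets (A : nat -> set T) (e : nat -> R) :
  (forall k, measurable (A k)) -> (forall k, 0 < e k) ->
  (forall k, e k.+1 <= e k / 4) -> (forall k, ((e k)%:E <= mu (A k))%E) ->
  exists B : nat -> set T, [/\ forall k, measurable (B k), trivIset [set: nat] B,
    forall k, B k `<=` A k & forall k, e k / 2 <= fine (mu (B k)) <= e k].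
Proof.
move=> mA e0 e4 eA.
have /choice[C CP] : forall k, exists C,
    [/\ measurable C, C `<=` A k & mu C = (e k)%:E].
  by move=> k; apply: atomless_subset => //; exact: ltW.
have mC k : measurable (C k) by case: (CP k).
have mCe k : m (C k) = e k by have [_ _ h] := CP k; rewrite /m h.
pose tail k := \bigcup_j C (k + j.+1)%N.
have mt k : measurable (tail k) by exact: bigcup_measurable.
have edecay k j : e (k + j.+1)%N <= e k / 2 / (2 ^ j.+1)%:R.
  elim: j => [|j IH].
    by rewrite addn1 (le_trans (e4 k))//; have := e0 k; rewrite expn1; lra.
  rewrite addnS (le_trans (e4 _))// expnS natrM invfM.
  have := e0 (k + j.+1)%N; move: IH; set x := e _; set y := e k / 2.
  by rewrite [_ / (2 ^ _)%:R]mulrC => *; rewrite mulrA mulrAC; lra.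
have tail_le k : m (tail k) <= e k / 2.
  rewrite -lee_fin -muE//.
  apply: (@le_trans _ _ (\sum_(0 <= j <oo) mu (C (k + j.+1)%N))%E).
    by apply: measure_sigma_subadditive.
  apply: le_trans (@epsilon_trick0 _ (e k / 2) xpredT _); last first.
    by rewrite divr_ge0// ltW.
  by apply: lee_nneseries => // j _; rewrite muE// mCe lee_fin edecay.
exists (fun k => C k `\` tail k); split.
- by move=> k; exact: measurableD.
- have disj i j : (i < j)%N -> forall t, (C i `\` tail i) t -> C j t -> False.
    move=> ij t [_ nt] Cj; apply: nt; exists (j - i.+1)%N => //.
    by rewrite addnS -addSn subnKC.
  move=> i j _ _ [t [[Ci ti] [Cj tj]]].
  by case: (ltngtP i j) => // ij; exfalso;
    [exact: (disj i j ij t)|exact: (disj j i ij t)].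
- by move=> k t [Ct _]; case: (CP k) => _ + _; apply.
move=> k; rewrite -/(m _).
have mCt : measurable (C k `&` tail k) by exact: measurableI.
have h := @m_add (C k `&` tail k) (C k) mCt (mC k) (@subIsetl _ _ _).
have := m_le mCt (mt k) (@subIsetr _ _ _).
move: h; rewrite setDIr setDv set0U mCe => h1 h2.
have := tail_le k; have := m_ge0 (C k `&` tail k); move=> h3 h4.
by apply/andP; split; lra.
Qed.

End atomless_measure.

(** * Slow decay of the rearrangement of 1/q - 1/p *)

Section exponent_gap.
Context {d : measure_display} {T : measurableType d} {R : realType}.
Variables p q : T -> R.
Hypotheses (p_exp : exponent p) (q_exp : exponent q).

Let phi : T -> R := fun t => (p t - q t) / (p t * q t).

Lemma exponent_gap_le1 t : `|phi t| <= 1.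
Proof.
have p1 := p_exp.2 t; have q1 := q_exp.2 t.
have pq0 : 0 < p t * q t by rewrite mulr_gt0 ?exponent_gt0.
rewrite ler_norml /phi ler_pdivrMr// ler_pdivlMr//.
by apply/andP; split; nra.
Qed.

Lemma measurable_exponent_gap : measurable_fun [set: T] phi.
Proof.
have -> : phi = (fun t => (p t - q t) * (p t * q t) `^ (-1)).
  apply/funext => t; rewrite powR_inv1// mulr_ge0 ?ltW ?exponent_gt0//.
apply: measurable_funM; first exact: measurable_funB p_exp.1 q_exp.1.
exact: measurableT_comp (measurable_powR _) (measurable_funM p_exp.1 q_exp.1).
Qed.

End exponent_gap.

Section necessary_condition.
Context {d : measure_display} {T : measurableType d} {R : realType}.
Variable mu : {finite_measure set T -> \bar R}.
Variables p q : T -> R.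
Hypotheses (mu_atomless : atomless mu) (p_exp : exponent p) (q_exp : exponent q).
Hypothesis qp : {ae mu, forall t, q t <= p t}.

Let phi : T -> R := fun t => (p t - q t) / (p t * q t).
Let level (c e : R) : set T := [set t | c <= e `^ `|phi t|].

Let measurable_level c e : measurable (level c e).
Proof.
have mf : measurable_fun [set: T] (fun t => c <= e `^ `|phi t|).
  apply: measurable_fun_ler; first exact: measurable_cst.
  apply: measurable_fun_powR_fun; first exact: measurable_cst.
  by apply: measurableT_comp => //; exact: measurable_exponent_gap.
have := mf measurableT [set true] I; rewrite setTI.
by congr measurable; apply/seteqP; split => t; rewrite /level/=.
Qed.

(** The sets B_k found in the level sets have measure b_k in [e_k/2, e_k], so
    that b_k^phi >= b_k^|phi| >= 2^(-|phi|) e_k^|phi| >= c/2 on B_k. *)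
Lemma large_levels_not_DSS (c : R) : 0 < c ->
  (forall eta : R, 0 < eta -> exists e, [/\ 0 < e, e < eta, e < 1 &
     (e%:E <= mu (level c e))%E]) -> ~ inclusion_DSS mu p q.
Proof.
move=> c0 H.
have /choice[g gP] : forall eta, exists e, 0 < eta -> [/\ 0 < e, e < eta, e < 1 &
     (e%:E <= mu (level c e))%E].
  move=> eta; have [eta0|_] := boolP (0 < eta); last by exists 0.
  by have [e ?] := H eta eta0; exists e.
pose e k := iter k (fun x => g (x / 4)) (g 1).
have e0 k : 0 < e k.
  elim: k => [|k IH]; first by case: (gP 1 ltr01).
  by have [] := gP (e k / 4) (divr_gt0 IH _).
have eg k : e k < 1 /\ ((e k)%:E <= mu (level c (e k)))%E.
  case: k => [|k]; first by case: (gP 1 ltr01).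
  by have [] := gP (e k / 4) (divr_gt0 (e0 k) _).
have e4 k : e k.+1 <= e k / 4.
  by have [//|_ + _ _] := gP (e k / 4) (divr_gt0 (e0 k) _); exact: ltW.
have [B [mB tB BA Be]] := disjoint_subsets mu_atomless
  (fun k => measurable_level c (e k)) e0 e4 (fun k => (eg k).2).
have b0 k : 0 < fine (mu (B k)).
  by have /andP[+ _] := Be k; apply: lt_le_trans; rewrite divr_gt0.
apply: (@disjoint_bumps_not_DSS _ _ _ mu p q p_exp q_exp qp B (c / 2)) => //.
- by move=> k; have := b0 k; rewrite -lte_fin fineK// fin_num_measure.
- exact: divr_gt0.
move=> k t Bt; have /andP[be1 be2] := Be k; have [e1 _] := eg k.
have phi1 := exponent_gap_le1 p_exp q_exp t; rewrite -/(phi t) in phi1 *.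
apply: (@le_trans _ _ (fine (mu (B k)) `^ `|phi t|)); last first.
  by rewrite ger_powR ?ler_norm// b0 (le_trans be2)// ltW.
apply: (@le_trans _ _ ((e k / 2) `^ `|phi t|)); last first.
  by rewrite ge0_ler_powR ?nnegrE// ltW// divr_gt0.
rewrite powRM ?invr_ge0 ?(ltW (e0 k))//.
apply: ler_pM; [exact: ltW|by rewrite invr_ge0|exact: (BA k t Bt)|].
by rewrite ger1_powR// invr_gt0 ltr0n invf_le1// ler1n.
Qed.

Let M : R := fine (mu [set: T]).
Let f (x : R) : R := (M - x) `^ fine (decreasing_rearrangement mu phi x).

(** With D = phi^*(x), some s < D + tau satisfies mu {|phi| > s} <= x, so that
    {|phi| <= s} has measure at least M - x. *)
Lemma rearrangement_level (x : R) (delta : R) : 0 <= x -> x < M -> M - x < 1 ->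
  0 < delta -> delta <= f x -> ((M - x)%:E <= mu (level (delta / 2) (M - x)))%E.
Proof.
move=> x0 xM; rewrite /f; set e := M - x; set D := decreasing_rearrangement _ _ _.
move=> e1 delta0 deltaf.
have e0 : 0 < e by rewrite subr_gt0.
have D0 : (0 <= D)%E by apply/ereal_infP => _ [s [s0 _] <-]; rewrite lee_fin.
(* The rearrangement is finite, so that taking [fine] is harmless. *)
have D1 : (D <= 1)%E.
  apply: ereal_inf_lbound; exists 1 => //; split => //.
  rewrite /distribution_function (_ : [set t | _] = set0) ?measure0 ?lee_fin//.
  by apply/seteqP; split => // t /=; rewrite ltNge exponent_gap_le1.
have DE : D = (fine D)%:E.
  by rewrite fineK// fin_numE -ltNye -ltey (lt_le_trans _ D0)// (le_lt_trans D1) ?ltry.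
(* tau is the increment of the exponent that halves e `^ D. *)
pose tau := ln 2 / - ln e.
have lne : 0 < - ln e by rewrite oppr_gt0 ln_lt0// e0.
have ln20 : 0 < ln (2 : R) by rewrite ln_gt0// ltr1n.
have tau0 : 0 < tau by rewrite divr_gt0.
have etau : e `^ tau = 2^-1.
  rewrite /powR gt_eqF// /tau -[ln e]opprK mulrN opprK divfK ?gt_eqF//.
  by rewrite expRN lnK// posrE.
have : (D < (fine D + tau)%:E)%E by rewrite [ltLHS]DE lte_fin ltrDl.
case/ereal_inf_lt => _ [s [s0 sx] <-]; rewrite lte_fin => sD.
have mphi : measurable_fun [set: T] phi by exact: measurable_exponent_gap.
have mL : measurable [set t | s < `|phi t|].
  have mf : measurable_fun [set: T] (fun t => s < `|phi t|).
    apply: measurable_fun_ltr; first exact: measurable_cst.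
    exact: measurableT_comp.
  have := mf measurableT [set true] I; rewrite setTI.
  by congr measurable; apply/seteqP; split => t.
apply: (@le_trans _ _ (mu (~` [set t | s < `|phi t|]))).
  have h := measureDI mu measurableT mL; rewrite setTD setTI in h.
  have fin1 := fineK (fin_num_measure mu _ mL).
  have fin2 := fineK (fin_num_measure mu _ (measurableC mL)).
  have hM : M = fine (mu (~` [set t | s < `|phi t|])) + fine (mu [set t | s < `|phi t|]).
    by rewrite /M h fineD// fin_num_measure//; exact: measurableC.
  have sx' : fine (mu [set t | s < `|phi t|]) <= x by rewrite -lee_fin fin1.
  by rewrite -fin2 lee_fin /e; lra.
apply: le_measure; rewrite ?inE//; first exact: measurableC.
move=> t /= /negP; rewrite -leNgt => phis; rewrite /level/=.
apply: (@le_trans _ _ (e `^ (fine D + tau))).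
  rewrite powRD ?(gt_eqF e0) ?implybT// etau ler_wpM2r ?invr_ge0//.
by rewrite ger_powR ?e0 ?(ltW e1)// (le_trans phis)// ltW.
Qed.

End necessary_condition.

(* The limit is taken along [0, mu(Omega)[, the domain of the rearrangement;
   for mu(Omega) > 0 it is the left limit at mu(Omega). The rearranged function
   has values in [0, 1[ almost everywhere, so [fine] is harmless there. *)
Theorem proposition3p3 (d : measure_display) (T : measurableType d)
    (R : realType) (mu : {finite_measure set T -> \bar R}) (p q : T -> R)
    (mu_atomless : atomless mu)
    (p_exponent : exponent p) (q_exponent : exponent q)
    (le_qp : {ae mu, forall t, q t <= p t})
    (dss : inclusion_DSS mu p q) :
  let M : R := fine (mu [set: T]) in
  let phi : T -> R := fun t => (p t - q t) / (p t * q t) in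
  (M - x) `^ fine (decreasing_rearrangement mu phi x)
    @[x --> within `[0, M[ (nbhs M)] --> (0 : R).
Proof.
move=> M phi; apply/cvgrPdist_lt => delta delta0.
rewrite near_withinE; apply: contrapT => notlim.
apply: (@large_levels_not_DSS _ _ _ mu p q mu_atomless p_exponent q_exponent
  le_qp (delta / 2)) dss; first by rewrite divr_gt0.
move=> eta eta0.
have eta1 : 0 < Num.min eta 1 by rewrite lt_min eta0 ltr01.
apply: contrapT => nolevel; apply: notlim.
exists (Num.min eta 1) => //= x /=; rewrite lt_min => /andP[xeta x1].
rewrite in_itv/= => /andP[x0 xM].
rewrite sub0r normrN ger0_norm ?powR_ge0// ltNge; apply/negP => big.
rewrite gtr0_norm ?subr_gt0// in xeta x1.
apply: nolevel; exists (M - x); split => //; first by rewrite subr_gt0.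
exact: rearrangement_level.
Qed.
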